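(* Let $n\ge1$, let $h\in\mathbb{R}$ with $h\ne0$, let $K$ be a symmetric real $n\times n$ matrix, let $W\colon\mathbb{R}^n\to\mathbb{R}$ be a (possibly nonhomogeneous) polynomial of degree $\le4$, and let $f=-K\nabla W$, a (possibly nonhomogeneous) polynomial vector field of degree $\le 3$. The map $(x_0,x_1)\mapsto(x_1,x_2)$ on $\mathbb{R}^{2n}$ in which $x_2$ is determined by $$x_2-2x_1+x_0=h^2\,\mathrm{pol}_3 f(x_0,x_1,x_2)$$ has the invariant measure $$\frac{\prod dx}{\det\left(I-\frac{h^2}{3}\,\mathrm{pol}_2\,\mathrm{D}f(x_0,x_1)\right)},$$ where $\prod dx$ is the standard Euclidean volume form on $\mathbb{R}^{2n}\ni(x_0,x_1)$ and $\mathrm{D}f$ is the Jacobian matrix of $f$.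
   Context: Polarization: for a homogeneous polynomial $g$ of degree $d$ (scalar-, vector- or matrix-valued) on a real vector space, its polarization is the unique symmetric $d$-linear form $G$ with $G(x,\dots,x)=g(x)$; equivalently, $G(x_0,\dots,x_{d-1})$ is $\frac1{d!}$ times the coefficient of $\lambda_0\cdots\lambda_{d-1}$ in $g(\lambda_0x_0+\dots+\lambda_{d-1}x_{d-1})$. For a possibly nonhomogeneous polynomial map $g$ on $\mathbb{R}^n$ of degree $\le d$, its homogenization is $\tilde g(x,z)=z^dg(x/z)$, homogeneous of degree $d$ on $\mathbb{R}^{n+1}$ (with $z\in\mathbb{R}$), and $\mathrm{pol}_d\,g(x_0,\dots,x_{d-1})$ denotes the polarization of $\tilde g$ evaluated at $(x_0,1),\dots,(x_{d-1},1)$. For vector- or matrix-valued $g$ this is applied entrywise; in particular $\mathrm{pol}_2\,\mathrm{D}f(x_0,x_1)$ is an $n\times n$ matrix. A rational density $\rho(x_0,x_1)$ times the standard Euclidean volume form is called an invariant measure of the rational map $\phi\colon(x_0,x_1)\mapsto(x_1,x_2)$ if $\rho(x_1,x_2)\,\det \mathrm{D}\phi(x_0,x_1)=\rho(x_0,x_1)$ wherever both sides are defined. The density may change sign. The map is defined where the defining equation, which is affine in $x_2$, is uniquely solvable for $x_2$. *)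

(* Defs.v *)
From HB Require Import structures.
From mathcomp Require Import all_boot all_order all_algebra.
From mathcomp Require Import boolp classical_sets reals topology normedtype derive.
From mathcomp Require mpoly.
(* The notations of mpoly cannot be parsed next to those of normedtype. *)
Export -(notations) mpoly.

Set Implicit Arguments.
Unset Strict Implicit.
Unset Printing Implicit Defensive.

Import GRing.Theory Num.Theory.
Export numFieldNormedType.Exports.

#[global] Open Scope ring_scope.
#[global] Open Scope classical_set_scope.

(* Points of R^n are row vectors 'rV[R]_n, and (x_0, x_1) in R^(2n) is
   row_mx x_0 x_1. *)
Definition peval (R : realType) (n : nat) (g : mpoly n R) (x : 'rV[R]_n) : R :=
  meval (fun i => x 0 i) g.

Definition coord_poly (R : realType) (n : nat) (i : 'I_n) : mpoly n R :=
  mpolyX R (mnm1 i).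

(* (1 / d!) times the coefficient of l_0 ... l_(d-1) in
   G (l_0 x_0 + ... + l_(d-1) x_(d-1)), which is expanded in the polynomial
   ring in the d indeterminates l_0, ..., l_(d-1). *)
Definition polarization (R : realType) (d n : nat) (G : mpoly n R)
    (x : d.-tuple 'rV[R]_n) : R :=
  (d`!%:R)^-1 *
  mcoeff (Multinom [tuple 1%N | i < d])
    (comp_mpoly [tuple \sum_(i < d) tnth x i 0 j *: coord_poly R i | j < n] G).

(* The last of the n + 1 indeterminates is the homogenizing one. The truncated
   subtraction is harmless for g of degree at most d. *)
Definition homogenize (R : realType) (d n : nat) (g : mpoly n R) :
    mpoly (n + 1) R :=
  \sum_(m <- msupp g) mcoeff m g *:
    ((\prod_(i < n) coord_poly R (lshift 1 i) ^+ m i) *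
     coord_poly R (rshift n ord0) ^+ (d - mdeg m)).

Lemma homogenizeE (R : realType) (d n : nat) (g : mpoly n R) (x : 'rV[R]_n)
    (z : R) : (msize g <= d.+1)%N -> z != 0 ->
  peval (homogenize d g) (row_mx x z%:M) = z ^+ d * peval g (z^-1 *: x).
Proof.
move=> gd z0; rewrite /peval /homogenize raddf_sum /= mevalE mulr_sumr.
apply: eq_big_seq => m mg.
have md : (mdeg m <= d)%N by rewrite -ltnS (leq_trans _ gd) // msize_mdeg_lt.
have -> : \prod_(i < n) (z^-1 *: x) 0 i ^+ m i =
    z ^- mdeg m * \prod_(i < n) x 0 i ^+ m i.
  under eq_bigr do rewrite mxE exprMn.
  by rewrite big_split /= prodrXr mdegE exprVn.
rewrite mevalZ mevalM rmorphXn rmorph_prod /= mevalXU row_mxEr mxE eqxx mulr1n.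
have -> : \prod_(i < n) meval (fun i => row_mx x z%:M 0 i)
    (coord_poly R (lshift 1 i) ^+ m i) = \prod_(i < n) x 0 i ^+ m i.
  by apply: eq_bigr => i _; rewrite rmorphXn /= mevalXU row_mxEl.
rewrite [RHS]mulrCA; congr (_ * _).
rewrite mulrC mulrA; congr (_ * _).
by rewrite expfB_cond // (negbTE z0) add0n.
Qed.

Definition pol (R : realType) (d n : nat) (g : mpoly n R)
    (x : d.-tuple 'rV[R]_n) : R :=
  polarization (homogenize d g) [tuple row_mx (tnth x i) 1%:M | i < d].

Definition pol_mx (R : realType) (d n p q : nat) (A : 'M[mpoly n R]_(p, q))
    (x : d.-tuple 'rV[R]_n) : 'M[R]_(p, q) :=
  \matrix_(i, j) pol (A i j) x.

Definition gradient (R : realType) (n : nat) (W : mpoly n R) :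
    'cV[mpoly n R]_n := \col_j mderiv j W.

Definition jacobian_mx (R : realType) (n : nat) (f : 'rV[mpoly n R]_n) :
    'M[mpoly n R]_n := \matrix_(i, j) mderiv j (f 0 i).

Definition gradient_field (R : realType) (n : nat) (K : 'M[R]_n)
    (W : mpoly n R) : 'rV[mpoly n R]_n :=
  (- (map_mx (@mpolyC n R) K *m gradient W))^T.

Definition step_eq (R : realType) (n : nat) (h : R) (f : 'rV[mpoly n R]_n)
    (x0 x1 x2 : 'rV[R]_n) : Prop :=
  x2 - 2%:R *: x1 + x0 = h ^+ 2 *: pol_mx f [tuple x0; x1; x2].

Definition step_dom (R : realType) (n : nat) (h : R) (f : 'rV[mpoly n R]_n) :
    set 'rV[R]_(n + n) :=
  [set x | exists! x2 : 'rV[R]_n, step_eq h f (lsubmx x) (rsubmx x) x2].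

(* Meaningful on step_dom h f only, where xget picks the unique solution. *)
Definition step_map (R : realType) (n : nat) (h : R) (f : 'rV[mpoly n R]_n)
    (x : 'rV[R]_(n + n)) : 'rV[R]_(n + n) :=
  row_mx (rsubmx x)
    (xget 0 [set x2 : 'rV[R]_n | step_eq h f (lsubmx x) (rsubmx x) x2]).

Definition density_mx (R : realType) (n : nat) (h : R) (f : 'rV[mpoly n R]_n)
    (x : 'rV[R]_(n + n)) : 'M[R]_n :=
  1%:M - (h ^+ 2 / 3%:R) *:
    pol_mx (jacobian_mx f) [tuple lsubmx x; rsubmx x].

Definition density_dom (R : realType) (n : nat) (h : R)
    (f : 'rV[mpoly n R]_n) : set 'rV[R]_(n + n) :=
  [set x | \det (density_mx h f x) != 0].

Definition density (R : realType) (n : nat) (h : R) (f : 'rV[mpoly n R]_n)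
    (x : 'rV[R]_(n + n)) : R := (\det (density_mx h f x))^-1.

Definition rational_on (R : realType) (N : nat) (D : set 'rV[R]_N)
    (g : 'rV[R]_N -> R) : Prop :=
  exists p q : mpoly N R,
    forall x, D x -> peval q x != 0 /\ g x = peval p x / peval q x.

(* A partial map is a total one together with its domain of definition.
   The library's jacobian acts on row vectors from the right, hence is the
   transpose of the matrix of partial derivatives; the determinant is the
   same. *)
Definition invariant_measure (R : realType) (N : nat)
    (Dphi : set 'rV[R]_N) (phi : 'rV[R]_N -> 'rV[R]_N)
    (Drho : set 'rV[R]_N) (rho : 'rV[R]_N -> R) : Prop :=
  [/\ forall k : 'I_N, rational_on Dphi (fun x => phi x 0 k),
      rational_on Drho rho &
      forall x, Dphi x -> Drho x -> Drho (phi x) ->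
        differentiable phi x /\
        rho (phi x) * \det (jacobian phi x) = rho x].

(* Main.v *)
From HB Require Import structures.
Require Import Defs.
From mathcomp Require Import all_boot all_order all_algebra.
From mathcomp Require Import boolp classical_sets functions reals topology.
From mathcomp Require Import normedtype landau derive.

(** Write F for the polarization of f: it is symmetric, and affine in each
    argument. The linear part of F in its last argument is one third of the
    polarization of the Jacobian matrix in the other arguments
    ([pol_mxB_last]), so

      M(x0, x1) = I - h^2/3 pol_2 Df(x0, x1)

    is exactly the matrix of the linear system that the defining equation
    imposes on x2 ([step_eqE]). Hence the map phi is defined precisely where
    det M does not vanish ([step_domE]), and Cramer's rule presents it there
    as a rational, hence differentiable, map.

    For the Jacobian determinant, move x0 to y0 with x1 fixed, let x2 move to
    y2 accordingly, and subtract the two defining equations. Since F is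
    symmetric, the change of F splits exactly into a term in y2 - x2 with
    matrix pol_2 Df(x0, x1)/3 and a term in y0 - x0 with matrix
    pol_2 Df(x1, y2)/3, and the subtraction reads

      M(x0, x1) (y2 - x2) = - M(x1, y2) (y0 - x0)    ([step_eq_increment]).

    Dividing by the size of the displacement and passing to the limit gives
    M(x0, x1) dx2/dx0 = - M(x1, x2). As the first component of phi is x1, the
    Jacobian matrix of phi is a block matrix whose determinant is
    det (- dx2/dx0), that is det M(x1, x2) / det M(x0, x1)
    ([det_jacobian_step_map]). This is the invariance of 1 / det M.

    The properties of polarizations come from one description: polarizing is
    taking iterated directional derivatives at the origin, divided by d!
    ([polarizationE]). Symmetry is then the commutation of partial
    derivatives, and the linear part in one argument comes from homogenization
    commuting with partial derivatives ([mderiv_homogenize]). *)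

Set Implicit Arguments.
Unset Strict Implicit.
Unset Printing Implicit Defensive.

Import GRing.Theory Num.Theory.

(** * Iterated directional derivatives of polynomials *)

Section DirectionalDerivative.
Variables (R : realType) (n : nat).
Implicit Types (G : mpoly n R) (u v : 'rV[R]_n).

Definition dderiv v G : mpoly n R := \sum_j v 0 j *: mderiv j G.

Lemma dderivBl u v G : dderiv (u - v) G = dderiv u G - dderiv v G.
Proof.
rewrite /dderiv -sumrB; apply: eq_bigr => j _.
by rewrite !mxE scalerBl.
Qed.

Lemma dderiv_sum (I : Type) (r : seq I) (P : pred I) (a : I -> R)
    (F : I -> mpoly n R) v :
  dderiv v (\sum_(i <- r | P i) a i *: F i) =
  \sum_(i <- r | P i) a i *: dderiv v (F i).
Proof.
rewrite /dderiv.
under eq_bigr do rewrite (raddf_sum (@mderiv n R _)) scaler_sumr.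
rewrite exchange_big; apply: eq_bigr => i _.
rewrite scaler_sumr; apply: eq_bigr => j _ /=.
by rewrite mderivZ !scalerA mulrC.
Qed.

Lemma mderiv_dderiv j v G : mderiv j (dderiv v G) = dderiv v (mderiv j G).
Proof.
rewrite /dderiv raddf_sum; apply: eq_bigr => i _ /=.
by rewrite mderivZ mderiv_comm.
Qed.

Lemma dderivC u v G : dderiv u (dderiv v G) = dderiv v (dderiv u G).
Proof.
rewrite {2}/dderiv dderiv_sum; apply: eq_bigr => j _.
by rewrite mderiv_dderiv.
Qed.

Definition dderivs (s : seq 'rV[R]_n) G : mpoly n R := foldr dderiv G s.

Lemma dderivs_sum (I : Type) (r : seq I) (P : pred I) (a : I -> R)
    (F : I -> mpoly n R) s :
  dderivs s (\sum_(i <- r | P i) a i *: F i) =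
  \sum_(i <- r | P i) a i *: dderivs s (F i).
Proof. by elim: s => //= v s ->; rewrite dderiv_sum. Qed.

Lemma dderivs_dderiv s v G : dderivs s (dderiv v G) = dderiv v (dderivs s G).
Proof. by elim: s => //= u s ->; rewrite dderivC. Qed.

Lemma dderivs_perm s t G : perm_eq s t -> dderivs s G = dderivs t G.
Proof.
elim: s t => [|v s IH] t st.
  by rewrite perm_sym in st; rewrite (perm_nilP st).
have vt : v \in t by rewrite -(perm_mem st) mem_head.
case/splitPr: vt st => t1 t2.
rewrite perm_sym -cat1s (perm_catCA t1 [:: v] t2) perm_cons perm_sym.
move=> /IH /= ->.
by rewrite /dderivs !foldr_cat -[LHS]/(dderiv v (dderivs t1 _)) -dderivs_dderiv.
Qed.

End DirectionalDerivative.

Section ChainRule.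
Variables (R : realType) (n k : nat).

(** The identity is linear in G and, by the Leibniz rule, holds for a product
    as soon as it holds for the factors; so the case of a single variable
    suffices. *)
Lemma mderiv_comp_mpoly i (G : mpoly n R) (lq : n.-tuple (mpoly k R)) :
  mderiv i (comp_mpoly lq G) =
  \sum_(j < n) comp_mpoly lq (mderiv j G) * mderiv i (tnth lq j).
Proof.
pose P G := mderiv i (comp_mpoly lq G) =
  \sum_(j < n) comp_mpoly lq (mderiv j G) * mderiv i (tnth lq j).
have P1 : P 1.
  rewrite /P comp_mpoly1 -mpolyC1 mderivC big1 // => j _.
  by rewrite -mpolyC1 mderivC comp_mpoly0 mul0r.
have PM p q : P p -> P q -> P (p * q).
  rewrite /P rmorphM mderivM => -> ->.
  rewrite mulr_suml mulr_sumr -big_split; apply: eq_bigr => j _ /=.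
  by rewrite mderivM comp_mpolyD !rmorphM /= mulrDl mulrA mulrAC.
have PX j : P (mpolyX R (mnm1 j)).
  rewrite /P comp_mpolyXU (bigD1 j) //= big1 ?addr0.
    rewrite mderivX mnm1E eqxx scale1r -{1}(add0m (mnm1 j)) addmK mpolyX0.
    by rewrite comp_mpoly1 mul1r (tnth_nth 0).
  move=> l lj; rewrite mderivX mnm1E eq_sym (negbTE lj) scale0r.
  by rewrite comp_mpoly0 mul0r.
have Pm m : P (mpolyX R m).
  rewrite mpolyXE_id; elim/big_ind: _ => // j _.
  by elim: (m j) => // c IH; rewrite exprS; apply: PM.
elim/mpolyind: G => [|c m p _ _ IH].
  rewrite comp_mpoly0 mderiv0 big1 // => j _.
  by rewrite mderiv0 comp_mpoly0 mul0r.
rewrite comp_mpolyD comp_mpolyZ mderivD mderivZ IH (Pm m).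
rewrite scaler_sumr -big_split.
apply: eq_bigr => j _ /=.
by rewrite mderivD mderivZ comp_mpolyD comp_mpolyZ mulrDl scalerAl.
Qed.

(** The linear forms L have constant partial derivative x_i in the i-th
    variable, so the chain rule turns that partial derivative into the
    directional derivative along x_i. *)
Lemma mderivs_comp_linear (x : k.-tuple 'rV[R]_n) (s : seq 'I_k)
    (G : mpoly n R) :
  let L := [tuple \sum_(i < k) tnth x i 0 j *: coord_poly R i | j < n] in
  foldr (@mderiv k R) (comp_mpoly L G) s =
  comp_mpoly L (dderivs [seq tnth x i | i <- s] G).
Proof.
move=> L; elim: s => //= i s ->; rewrite mderiv_comp_mpoly /dderiv.
rewrite raddf_sum; apply: eq_bigr => j _ /=.
rewrite comp_mpolyZ tnth_mktuple (raddf_sum (@mderiv k R i)) (bigD1 i) //=.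
rewrite big1 ?addr0.
  rewrite mderivZ mderivX mnm1E eqxx scale1r -{1}(add0m (mnm1 i)) addmK.
  rewrite mpolyX0.
  by rewrite -scalerAr mulr1.
move=> l li; rewrite mderivZ mderivX mnm1E (negbTE li).
by rewrite scale0r scaler0.
Qed.

End ChainRule.

(** * Polarization as an iterated derivative *)

Section Polarization.
Variable R : realType.

Lemma mcoeff0_peval n (p : mpoly n R) : mcoeff mnm0 p = peval p 0.
Proof.
rewrite /peval; elim/mpolyind: p => [|c m p _ _ IH].
  by rewrite meval0 mcoeff0.
rewrite mcoeffD mcoeffZ mcoeffX mevalD mevalZ mevalX IH; congr (_ * _ + _).
under eq_bigr do rewrite mxE.
by rewrite prodrXr -mdegE expr0n mdeg_eq0.
Qed.

(** The coefficient of a multilinear monomial is the constant term of the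
    corresponding mixed partial derivative, without any factorial, because
    each variable has exponent one. *)
Lemma polarizationE d n (G : mpoly n R) (x : d.-tuple 'rV[R]_n) :
  polarization G x = (d`!%:R)^-1 * peval (dderivs x G) 0.
Proof.
rewrite /polarization; congr (_ * _); set L := [tuple _ | j < n].
set m := Multinom _; set P := comp_mpoly L G.
have mE i : m i = 1%N by rewrite multinomE tnth_mktuple.
have -> : mcoeff m P = mcoeff mnm0 (mderivm m P).
  rewrite mcoeff_mderivm addm0 big1 ?mulr1n // => i _.
  by rewrite mE ffactnn.
have -> : mderivm m P = foldr (@mderiv d R) P (enum 'I_d).
  by rewrite /mderivm; elim: (enum _) => //= i s ->; rewrite mE.
rewrite mderivs_comp_linear map_tnth_enum mcoeff0_peval /peval comp_mpoly_meval.
apply: meval_eq => j; rewrite tnth_mktuple mxE raddf_sum big1 // => i _ /=.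
by rewrite mevalZ mevalXU mxE mulr0.
Qed.

(** This gives the linearity of [homogenize], which is defined by a sum over
    a support that varies with the polynomial: both sums can be taken over
    the union of the supports, the additional coefficients being zero. *)
Lemma linear_msupp_sum n (V : lmodType R) (F : multinom n -> V) :
  linear (fun p : mpoly n R => \sum_(m <- msupp p) mcoeff m p *: F m).
Proof.
have widen (s : seq (multinom n)) (p : mpoly n R) : uniq s ->
    {subset msupp p <= s} ->
    \sum_(m <- msupp p) mcoeff m p *: F m = \sum_(m <- s) mcoeff m p *: F m.
  move=> us ps; rewrite [RHS](bigID (mem (msupp p)) predT) /=.
  rewrite [X in _ + X]big1 ?addr0.
    rewrite -[RHS]big_filter; apply: perm_big; apply: uniq_perm.
    - exact: msupp_uniq.
    - exact: filter_uniq.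
    - by move=> m; rewrite mem_filter; case: (boolP (m \in _)) => // /ps ->.
  by move=> m mp; rewrite memN_msupp_eq0 ?scale0r.
move=> a p q; set s := undup (msupp p ++ msupp q).
rewrite !(widen s) ?undup_uniq // => [|m|m|m].
- rewrite scaler_sumr -big_split; apply: eq_bigr => m _ /=.
  by rewrite mcoeffD mcoeffZ scalerDl scalerA.
- by rewrite mem_undup mem_cat => ->; rewrite orbT.
- by rewrite mem_undup mem_cat => ->.
- move=> /msuppD_le; rewrite mem_undup !mem_cat => /orP[/msuppZ_le ->//|->].
  by rewrite orbT.
Qed.

Lemma homogenize_is_linear d n : linear (@homogenize R d n).
Proof. exact: linear_msupp_sum. Qed.

HB.instance Definition _ d n :=
  GRing.isLinear.Build R (mpoly n R) (mpoly (n + 1) R) _ (@homogenize R d n)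
    (@homogenize_is_linear d n).

Lemma homogenizeX d n (m : multinom n) :
  homogenize d (mpolyX R m) =
  (\prod_(i < n) coord_poly R (lshift 1 i) ^+ m i) *
     coord_poly R (rshift n ord0) ^+ (d - mdeg m).
Proof. by rewrite /homogenize msuppX big_seq1 mcoeffX eqxx scale1r. Qed.

(** Differentiating a monomial in x_j lowers its degree and the target degree
    by one together, so the exponent of the homogenizing variable does not
    change. *)
Lemma mderiv_homogenize d n (g : mpoly n R) (j : 'I_n) :
  mderiv (lshift 1 j) (homogenize d.+1 g) = homogenize d (mderiv j g).
Proof.
elim/mpolyind: g => [|c m p _ _ IH]; first by rewrite mderiv0 !linear0.
rewrite [homogenize _ _]linearP mderivD mderivZ IH mderivD mderivZ.
rewrite [homogenize _ (_ + _)]linearP; congr (_ *: _ + _).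
rewrite mderivX [RHS]linearZ /= !homogenizeX.
(* The part of the monomial in the original variables is the image of
   'X_[m] under the inclusion of variables e, to which the chain rule
   applies. *)
pose e := [tuple coord_poly R (lshift 1 i) | i < n].
have eX (m' : multinom n) :
    \prod_(i < n) coord_poly R (lshift 1 i) ^+ m' i =
    comp_mpoly e (mpolyX R m').
  by rewrite comp_mpolyX; apply: eq_bigr => i _; rewrite tnth_mktuple.
have dz k : mderiv (lshift 1 j) (coord_poly R (rshift n (@ord0 0)) ^+ k) = 0.
  elim: k => [|k IHk]; first by rewrite expr0 -mpolyC1 mderivC.
  rewrite exprS mderivM IHk mulr0 addr0 mderivX mnm1E eq_rlshift.
  by rewrite scale0r mul0r.
have dx l : mderiv (lshift 1 j) (tnth e l) = (l == j)%:R.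
  rewrite tnth_mktuple mderivX mnm1E eq_lshift; case: eqP => [->|_].
    by rewrite scale1r -{1}(add0m (mnm1 _)) addmK mpolyX0.
  by rewrite scale0r.
rewrite !eX mderivM dz mulr0 addr0 mderiv_comp_mpoly (bigD1 j) //=.
rewrite big1; last first.
  by move=> l lj; rewrite dx (negbTE lj) mulr0.
rewrite dx eqxx mulr1 addr0 mderivX comp_mpolyZ -scalerAl.
have [->|mj] := posnP (m j); first by rewrite !scale0r.
have mE : m = mnm_add (mnm_sub m (mnm1 j)) (mnm1 j).
  by rewrite submK // lep1mP -lt0n.
by rewrite {3}mE mdegD mdeg1 (addn1 (mdeg _)) subSS.
Qed.

Lemma polE d n (g : mpoly n R) (x : d.-tuple 'rV[R]_n) :
  pol g x = (d`!%:R)^-1 *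
    peval (dderivs [seq row_mx v 1%:M | v <- x] (homogenize d g)) 0.
Proof.
rewrite /pol polarizationE; congr (_ * peval (dderivs _ _) 0).
by rewrite -[in RHS](map_tnth_enum x) -map_comp.
Qed.

Lemma pol_perm d n (g : mpoly n R) (x y : d.-tuple 'rV[R]_n) :
  perm_eq x y -> pol g x = pol g y.
Proof. by move=> xy; rewrite !polE (dderivs_perm _ (perm_map _ xy)). Qed.

(** Two homogenized points (x, 1) and (y, 1) differ by (x - y, 0), which has
    no component along the homogenizing variable; only the partial
    derivatives of g itself remain. The factor 1 / (d + 1) is the quotient
    of the two factorials. *)
Lemma polB d n (g : mpoly n R) (x y : 'rV[R]_n) (s : d.-tuple 'rV[R]_n) :
  pol g [tuple of x :: s] - pol g [tuple of y :: s] =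
  (d.+1%:R)^-1 * \sum_j (x - y) 0 j * pol (mderiv j g) s.
Proof.
rewrite !polE /= -mulrBr factS natrM invfM -mulrA; congr (_ * _).
under eq_bigr do rewrite polE mulrCA.
rewrite -mulr_sumr; congr (_ * _).
rewrite /peval -mevalB -dderivBl opp_row_mx add_row_mx subrr -dderivs_dderiv.
have -> : dderiv (row_mx (x - y) 0) (homogenize d.+1 g) =
    \sum_j (x - y) 0 j *: homogenize d (mderiv j g).
  rewrite /dderiv big_split_ord /= [X in _ + X]big1 ?addr0.
    by apply: eq_bigr => j _; rewrite row_mxEl mderiv_homogenize.
  by move=> j _; rewrite row_mxEr mxE scale0r.
rewrite dderivs_sum raddf_sum; apply: eq_bigr => j _.
exact: mevalZ.
Qed.

End Polarization.

(** * Polynomial functions *)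

Section PolynomialFunctions.
Variables (R : realType) (N : nat).
Implicit Types F G : 'rV[R]_N -> R.

Definition polyfun F := exists p : mpoly N R, F =1 peval p.

Lemma polyfun_cst c : polyfun (fun=> c).
Proof. by exists (mpolyC N c) => x; rewrite /peval mevalC. Qed.

Lemma polyfun_coord k : polyfun (fun x => x 0 k).
Proof. by exists (coord_poly R k) => x; rewrite /peval mevalXU. Qed.

Lemma polyfunD F G : polyfun F -> polyfun G -> polyfun (fun x => F x + G x).
Proof.
by move=> [p Fp] [q Gq]; exists (p + q) => x; rewrite Fp Gq /peval mevalD.
Qed.

Lemma polyfunM F G : polyfun F -> polyfun G -> polyfun (fun x => F x * G x).
Proof.
by move=> [p Fp] [q Gq]; exists (p * q) => x; rewrite Fp Gq /peval mevalM.
Qed.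

Lemma polyfunZ c F : polyfun F -> polyfun (fun x => c * F x).
Proof. exact/polyfunM/polyfun_cst. Qed.

Lemma polyfunN F : polyfun F -> polyfun (fun x => - F x).
Proof.
by move=> [p Fp]; exists (- p) => x; rewrite Fp /peval mevalN.
Qed.

Lemma polyfun_sum (I : Type) (r : seq I) (P : pred I) (F : I -> 'rV[R]_N -> R) :
  (forall i, polyfun (F i)) -> polyfun (fun x => \sum_(i <- r | P i) F i x).
Proof.
move=> PF; elim: r => [|i r [p rp]].
  by under eq_fun do rewrite big_nil; exact: polyfun_cst.
under eq_fun do rewrite big_cons; case: (P i); last by exists p.
by apply: polyfunD => //; exists p.
Qed.

Lemma polyfun_prod (I : Type) (r : seq I) (P : pred I)
    (F : I -> 'rV[R]_N -> R) :
  (forall i, polyfun (F i)) -> polyfun (fun x => \prod_(i <- r | P i) F i x).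
Proof.
move=> PF; elim: r => [|i r [p rp]].
  by under eq_fun do rewrite big_nil; exact: polyfun_cst.
under eq_fun do rewrite big_cons; case: (P i); last by exists p.
by apply: polyfunM => //; exists p.
Qed.

Lemma polyfun_mulmx m n p (A : 'rV[R]_N -> 'M[R]_(m, n))
    (B : 'rV[R]_N -> 'M[R]_(n, p)) :
  (forall i j, polyfun (fun x => A x i j)) ->
  (forall i j, polyfun (fun x => B x i j)) ->
  forall i j, polyfun (fun x => (A x *m B x) i j).
Proof.
move=> PA PB i j; under eq_fun do rewrite mxE.
by apply: polyfun_sum => k; apply: polyfunM.
Qed.

Lemma polyfun_det m (A : 'rV[R]_N -> 'M[R]_m) :
  (forall i j, polyfun (fun x => A x i j)) -> polyfun (fun x => \det (A x)).
Proof.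
move=> PA; rewrite /determinant; apply: polyfun_sum => s.
by apply: polyfunZ; apply: polyfun_prod.
Qed.

Lemma polyfun_adj m (A : 'rV[R]_N -> 'M[R]_m) :
  (forall i j, polyfun (fun x => A x i j)) ->
  forall i j, polyfun (fun x => (\adj (A x)) i j).
Proof.
move=> PA i j; under eq_fun do rewrite mxE.
apply: polyfunZ; apply: polyfun_det => k l.
by under eq_fun do rewrite !mxE.
Qed.

Lemma polyfun_pol d n (g : mpoly n R) (s : 'rV[R]_N -> d.-tuple 'rV[R]_n) :
  (forall i j, polyfun (fun x => tnth (s x) i 0 j)) ->
  polyfun (fun x => pol g (s x)).
Proof.
move=> Ps; under eq_fun do rewrite polE -(map_tnth_enum (s _)) -map_comp.
apply: polyfunZ; elim: (enum _) (homogenize d g) => [|i r IH] G /=.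
  exact: polyfun_cst.
under eq_fun do
  rewrite -[dderiv _ _]dderivs_dderiv dderivs_sum /peval raddf_sum.
apply: polyfun_sum => j; under eq_fun do rewrite /= mevalZ.
apply: polyfunM; last exact: IH.
have [k ->|k ->] := split_ordP j.
  by under eq_fun do rewrite row_mxEl.
by under eq_fun do rewrite row_mxEr; exact: polyfun_cst.
Qed.

Lemma polyfun_differentiable F x : polyfun F -> differentiable F x.
Proof.
move=> [p /funext ->]; elim/mpolyind: p => [|c m p _ _ IH].
  have -> : peval (0 : mpoly N R) = cst 0.
    by apply/funext => y; rewrite /peval meval0.
  exact: differentiable_cst.
have -> : peval (c *: mpolyX R m + p) =
    (fun y : 'rV[R]_N => c * \prod_(i < N) y 0 i ^+ m i) + peval p.
  by apply/funext => y; rewrite /peval mevalD mevalZ mevalX.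
apply: differentiableD => //; apply: differentiableM => //.
elim: (index_enum _) => [|i r IHr].
  by under eq_fun do rewrite big_nil; exact: differentiable_cst.
under eq_fun do rewrite big_cons.
apply: differentiableM => //; elim: (m i) => [|e IHe].
  by under eq_fun do rewrite expr0; exact: differentiable_cst.
under eq_fun do rewrite exprS.
by apply: differentiableM => //; exact: differentiable_coord.
Qed.

Lemma polyfun_continuous F : polyfun F -> continuous F.
Proof.
by move=> PF x; apply/differentiable_continuous/polyfun_differentiable.
Qed.

Lemma rational_on_div (D : set 'rV[R]_N) (F P Q : 'rV[R]_N -> R) :
  polyfun P -> polyfun Q ->
  (forall x, D x -> Q x != 0 /\ F x = P x / Q x) -> rational_on D F.
Proof.
move=> [p Pp] [q Qq] FD; exists p, q => x /FD.
by rewrite Pp Qq.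
Qed.

End PolynomialFunctions.

(** * Locally defined and row-valued differentiable maps *)

Section Differentiability.
Variable R : realType.

Lemma near_eq_differentiable (V W : normedModType R) (f g : V -> W) x :
  (\forall y \near x, f y = g y) -> differentiable g x -> differentiable f x.
Proof.
move=> fg dg; have fgx : f x = g x := nbhs_singleton fg.
have fE : f \o shift x = cst (f x) + 'd g x +o_ 0 id.
  apply/eqaddoP => e e0.
  have /eqaddoP /(_ e e0) := diff_locally dg.
  have : \forall y \near 0, f (y + x) = g (y + x).
    by move: fg; rewrite (near_shift 0) subr0.
  apply: filterS2 => y fgy /=.
  by rewrite !fctE /= fgy fgx.
have dfg := diff_unique (diff_continuous dg) fE.
by apply/diff_locallyP; rewrite dfg; split=> //; exact: diff_continuous.
Qed.

Lemma differentiable_rV (V : normedModType R) n (f : V -> 'rV[R]_n) x :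
  (forall k, differentiable (fun y => f y 0 k) x) -> differentiable f x.
Proof.
move=> df; have -> : f = \sum_k (fun y => f y 0 k *: delta_mx 0 k).
  by apply/funext => y; rewrite fct_sumE; apply: row_sum_delta.
apply: differentiable_sum => k.
exact: differentiableZl.
Qed.

End Differentiability.

(** A way to compute v *m jacobian F x from difference quotients: any
    continuous observable L of the quotients that extends continuously to
    t = 0 takes there the same value as on the directional derivative. *)
Lemma mul_jacobian_eq (R : realType) (N m : nat) (F : 'rV[R]_N -> 'rV[R]_m)
    (x v : 'rV[R]_N) (L : 'rV[R]_m -> R) (g : R -> R) :
  differentiable F x -> continuous L -> {for 0, continuous g} ->
  (\forall t \near 0^', L (t^-1 *: (F (t *: v + x) - F x)) = g t) ->
  L (v *m jacobian F x) = g 0.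
Proof.
move=> dF cL cg LFg; rewrite -deriveEjacobian //.
apply: (@cvg_unique _ _ (g t @[t --> 0^'])) => //.
  have dFv : derivable F x v := diff_derivable dF.
  apply: cvg_trans (continuous_cvg _ (cL _) dFv).
  exact: near_eq_cvg.
exact/continuous_withinNx.
Qed.

(** * A block determinant *)

Section Determinant.
Variables (R : comUnitRingType) (n : nat).

Lemma det_block0l (A B : 'M[R]_n) : \det (block_mx 0 A 1%:M B) = \det (- A).
Proof.
(* U *m L *m U is the rotation (0, -1; 1, 0), written as a product of
   unitriangular matrices so that its determinant is visibly 1. *)
pose U := block_mx 1%:M (- 1%:M) 0 1%:M : 'M[R]_(n + n).
pose L := block_mx 1%:M 0 1%:M 1%:M : 'M[R]_(n + n).
have SE : U *m L *m U = block_mx 0 (- 1%:M) 1%:M 0.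
  rewrite !mulmx_block !(mulmx1, mul1mx, mulmx0, mul0mx, addr0, add0r) subrr.
  by rewrite mul0mx add0r addNr.
have -> : block_mx 0 A 1%:M B = block_mx (- A) 0 (- B) 1%:M *m (U *m L *m U).
  rewrite SE mulmx_block !(mulmx1, mulmx0, mul0mx, addr0, add0r).
  by rewrite !mulmxN !mulmx1 !opprK.
by rewrite !det_mulmx det_lblock !det_ublock det_lblock !det1 !mulr1.
Qed.

End Determinant.

(** * The two-step map *)

Section Map.
Variables (R : realType) (n : nat) (h : R) (f : 'rV[mpoly n R]_n).
Local Notation M := (density_mx h f).
Local Notation phi := (step_map h f).
Implicit Types (x : 'rV[R]_(n + n)) (v w y z : 'rV[R]_n).

Lemma pol_mx_perm d (s t : d.-tuple 'rV[R]_n) :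
  perm_eq s t -> pol_mx f s = pol_mx f t.
Proof. by move=> st; apply/matrixP => i j; rewrite !mxE (pol_perm _ st). Qed.

Lemma pol_mxB d y z (s : d.-tuple 'rV[R]_n) :
  pol_mx f [tuple of y :: s] - pol_mx f [tuple of z :: s] =
  (d.+1%:R)^-1 *: ((y - z) *m (pol_mx (jacobian_mx f) s)^T).
Proof.
apply/rowP => i; rewrite !mxE polB; congr (_ * _).
by apply: eq_bigr => j _; rewrite !mxE.
Qed.

Lemma pol_mxB_last y z v w :
  pol_mx f [tuple v; w; y] - pol_mx f [tuple v; w; z] =
  3%:R^-1 *: ((y - z) *m (pol_mx (jacobian_mx f) [tuple v; w])^T).
Proof.
have E u : pol_mx f [tuple v; w; u] = pol_mx f [tuple of u :: [tuple v; w]].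
  by apply: pol_mx_perm; rewrite /= (perm_catC [:: v; w] [:: u]).
by rewrite !E pol_mxB.
Qed.

Lemma pol_mxB_first y z v w :
  pol_mx f [tuple y; v; w] - pol_mx f [tuple z; v; w] =
  3%:R^-1 *: ((y - z) *m (pol_mx (jacobian_mx f) [tuple v; w])^T).
Proof.
have E u : pol_mx f [tuple u; v; w] = pol_mx f [tuple of u :: [tuple v; w]].
  exact: pol_mx_perm.
by rewrite !E pol_mxB.
Qed.

Lemma mulmx_density y x :
  y *m (M x)^T = y - (h ^+ 2 / 3%:R) *:
    (y *m (pol_mx (jacobian_mx f) [tuple lsubmx x; rsubmx x])^T).
Proof.
by rewrite /density_mx linearB linearZ /= trmx1 mulmxBr mulmx1 -scalemxAr.
Qed.

Definition step_rhs x : 'rV[R]_n :=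
  2%:R *: rsubmx x - lsubmx x +
  h ^+ 2 *: pol_mx f [tuple lsubmx x; rsubmx x; 0].

Lemma step_eqE x y :
  step_eq h f (lsubmx x) (rsubmx x) y <-> y *m (M x)^T = step_rhs x.
Proof.
rewrite /step_eq /step_rhs mulmx_density.
have := pol_mxB_last y 0 (lsubmx x) (rsubmx x); rewrite subr0.
move/(canRL (subrK _)) => ->; rewrite scalerDr scalerA.
set a := _ *: (y *m _); set b := h ^+ 2 *: _.
have E : y - 2%:R *: rsubmx x + lsubmx x - (a + b) =
    y - a - (2%:R *: rsubmx x - lsubmx x + b).
  by rewrite !opprD opprK -[y - _ + _]addrA addrACA.
split=> /eqP; rewrite -subr_eq0; [rewrite E|rewrite -E];
  by rewrite subr_eq0 => /eqP.
Qed.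

(** A square linear system is uniquely solvable if and only if its matrix is
    invertible: a vector of the kernel would give a second solution. *)
Lemma step_domE : step_dom h f = density_dom h f.
Proof.
apply/seteqP; split=> x; rewrite /step_dom /density_dom /=.
  move=> [y [/step_eqE yE yU]]; apply/negP; rewrite -det_tr => /det0P[w w0 wM].
  have : y = y + w.
    by apply: yU; apply/step_eqE; rewrite mulmxDl wM addr0.
  by rewrite -{1}[y]addr0 => /addrI w_eq0; rewrite -w_eq0 eqxx in w0.
move=> d0; have MU : (M x)^T \in unitmx by rewrite unitmx_tr unitmxE unitfE.
exists (step_rhs x *m invmx (M x)^T); split.
  by apply/step_eqE; rewrite mulmxKV.
by move=> y /step_eqE <-; rewrite mulmxK.
Qed.

Lemma step_mapP x : step_dom h f x ->
  step_eq h f (lsubmx x) (rsubmx x) (rsubmx (phi x)).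
Proof. by move=> [y [yE _]]; rewrite row_mxKr; apply: xgetPex; exists y. Qed.

Lemma lsubmx_step_map x : lsubmx (phi x) = rsubmx x.
Proof. exact: row_mxKl. Qed.

(** Cramer's rule; the adjugate keeps the entries polynomial. *)
Lemma rsubmx_step_map x : step_dom h f x ->
  rsubmx (phi x) = (\det (M x))^-1 *: (step_rhs x *m \adj (M x)^T).
Proof.
move=> Dx; have /step_eqE <- := step_mapP Dx.
rewrite -mulmxA mul_mx_adj det_tr mul_mx_scalar scalerK //.
by rewrite step_domE in Dx.
Qed.

Lemma polyfun_density_mx i j : polyfun (fun x => M x i j).
Proof.
under eq_fun do rewrite !mxE.
apply: polyfunD; first exact: polyfun_cst.
apply/polyfunN/polyfunZ/polyfun_pol => k l.
under eq_fun do rewrite (tnth_nth 0).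
case: k => [[|[|//]] hk] /=; under eq_fun do rewrite mxE; exact: polyfun_coord.
Qed.

Lemma polyfun_det_density : polyfun (fun x => \det (M x)).
Proof. exact/polyfun_det/polyfun_density_mx. Qed.

Lemma polyfun_step_numerator k :
  polyfun (fun x => (step_rhs x *m \adj (M x)^T) 0 k).
Proof.
apply: polyfun_mulmx => [i j|]; last first.
  apply: polyfun_adj => i j; under eq_fun do rewrite mxE.
  exact: polyfun_density_mx.
rewrite (ord1 i); under eq_fun do rewrite !mxE.
apply: polyfunD; first apply: polyfunD.
- exact/polyfunZ/polyfun_coord.
- exact/polyfunN/polyfun_coord.
apply/polyfunZ/polyfun_pol => k' l; under eq_fun do rewrite (tnth_nth 0).
case: k' => [[|[|[|//]]] hk] /=; under eq_fun do rewrite mxE.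
- exact: polyfun_coord.
- exact: polyfun_coord.
- exact: polyfun_cst.
Qed.

Lemma rational_density : rational_on (density_dom h f) (density h f).
Proof.
apply: (@rational_on_div _ _ _ _ (fun=> 1) (fun x => \det (M x))).
- exact: polyfun_cst.
- exact: polyfun_det_density.
- by move=> x Dx; split=> //; rewrite mul1r.
Qed.

Lemma rational_step_map k : rational_on (step_dom h f) (fun x => phi x 0 k).
Proof.
have [j ->|j ->] := split_ordP k.
  apply: (@rational_on_div _ _ _ _ (fun x => x 0 (rshift n j)) (fun=> 1)).
  - exact: polyfun_coord.
  - exact: polyfun_cst.
  - by move=> x _; rewrite oner_neq0 divr1 row_mxEl mxE.
apply: (@rational_on_div _ _ _ _
    (fun x => (step_rhs x *m \adj (M x)^T) 0 j) (fun x => \det (M x))).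
- exact: polyfun_step_numerator.
- exact: polyfun_det_density.
- move=> x Dx; split; first by rewrite step_domE in Dx.
  have := rsubmx_step_map Dx; move/rowP/(_ j); rewrite [X in X = _]mxE => ->.
  by rewrite mxE mulrC.
Qed.

Lemma near_step_dom x : step_dom h f x -> \forall y \near x, step_dom h f y.
Proof.
rewrite step_domE => Dx.
have cdet := polyfun_continuous polyfun_det_density (x := x).
by have /(_ (nbhs_filter x) Dx) := cvgr_neq0 _ cdet.
Qed.

Lemma differentiable_step_map x : step_dom h f x -> differentiable phi x.
Proof.
move=> Dx; apply: differentiable_rV => k.
have [j ->|j ->] := split_ordP k.
  under eq_fun do rewrite row_mxEl mxE.
  exact: polyfun_differentiable (polyfun_coord _ _).
apply: (@near_eq_differentiable _ _ _ _
    (fun u => (\det (M u))^-1 * (step_rhs u *m \adj (M u)^T) 0 j)).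
  apply: filterS (near_step_dom Dx) => u Du.
  have := rsubmx_step_map Du; move/rowP/(_ j); rewrite [X in X = _]mxE => ->.
  by rewrite mxE.
apply: differentiableM.
  apply: differentiableV; last by rewrite step_domE in Dx.
  exact/polyfun_differentiable/polyfun_det_density.
exact/polyfun_differentiable/polyfun_step_numerator.
Qed.

(** The step that uses the symmetry of the polarization. Going from
    (x0, x1, x2) to (v + x0, x1, y2) through (x0, x1, y2), the change of the
    third argument is measured at (x0, x1) and that of the first one at
    (x1, y2): these are the arguments of M at a point and at the image of the
    displaced point. *)
Lemma step_eq_increment (x0 x1 x2 y2 v : 'rV[R]_n) :
  step_eq h f x0 x1 x2 -> step_eq h f (v + x0) x1 y2 ->
  (y2 - x2) *m (M (row_mx x0 x1))^T = - (v *m (M (row_mx x1 y2))^T).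
Proof.
rewrite /step_eq !mulmx_density !row_mxKl !row_mxKr => Ex Ey.
set a := _ *: ((y2 - x2) *m _).
set b := _ *: (v *m _).
have E : y2 - x2 + v = b + a.
  have -> : y2 - x2 + v =
      (y2 - 2%:R *: x1 + (v + x0)) - (x2 - 2%:R *: x1 + x0).
    by rewrite opprD addrACA addrK opprB addrA subrK.
  rewrite Ey Ex -scalerBr.
  rewrite -(subrKA (pol_mx f [tuple x0; x1; y2])).
  by rewrite pol_mxB_first pol_mxB_last addrK -scalerDr scalerA scalerDr.
by apply/eqP; rewrite opprB subr_eq addrAC -subr_eq opprK E.
Qed.

Lemma step_map_increment x u : rsubmx u = rsubmx x ->
  step_dom h f x -> step_dom h f u ->
  (rsubmx (phi u) - rsubmx (phi x)) *m (M x)^T =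
  - ((lsubmx u - lsubmx x) *m (M (phi u))^T).
Proof.
move=> ru /step_mapP Dx /step_mapP.
have phiE : row_mx (rsubmx x) (rsubmx (phi u)) = phi u.
  by rewrite -ru -(lsubmx_step_map u) hsubmxK.
rewrite ru -{1}(subrK (lsubmx x) (lsubmx u)) => /(step_eq_increment Dx).
by rewrite hsubmxK phiE.
Qed.

Lemma lsubmx_step_map_quotient x u w (t : R) : t != 0 ->
  rsubmx u = t *: w + rsubmx x ->
  lsubmx (t^-1 *: (phi u - phi x)) = w.
Proof.
have E (a b : 'rV[R]_(n + n)) : t != 0 -> lsubmx a = t *: w + lsubmx b ->
    lsubmx (t^-1 *: (a - b)) = w.
  move=> t0 ab; rewrite linearZ linearB /= ab.
  by rewrite addrK scalerA mulVf // scale1r.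
move=> t0; rewrite -(lsubmx_step_map u) -(lsubmx_step_map x).
exact: E.
Qed.

Lemma rsubmx_step_map_quotient x u w (t : R) :
  t != 0 -> rsubmx u = rsubmx x -> lsubmx u = t *: w + lsubmx x ->
  step_dom h f x -> step_dom h f u ->
  rsubmx (t^-1 *: (phi u - phi x)) *m (M x)^T =
  - (w *m (M (phi u))^T).
Proof.
have E (a b : 'rV[R]_(n + n)) (A B : 'M[R]_n) : t != 0 ->
    (rsubmx a - rsubmx b) *m A = - ((t *: w) *m B) ->
    rsubmx (t^-1 *: (a - b)) *m A = - (w *m B).
  move=> t0 ab; rewrite linearZ linearB /= -scalemxAl ab.
  by rewrite -scalemxAl -scalerN scalerA mulVf // scale1r.
move=> t0 ru lu Dx Du; apply: (E _ _ _ _ t0).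
have -> : t *: w = lsubmx u - lsubmx x by rewrite lu addrK.
exact: step_map_increment.
Qed.

Lemma lsubmx_jacobian_step_map x (v : 'rV[R]_(n + n)) : step_dom h f x ->
  lsubmx (v *m jacobian phi x) = rsubmx v.
Proof.
move=> Dx; apply/rowP => j.
pose L (z : 'rV[R]_(n + n)) := lsubmx z 0 j.
apply: (@mul_jacobian_eq _ _ _ phi x v L (cst (rsubmx v 0 j))).
- exact: differentiable_step_map.
- apply: polyfun_continuous; rewrite /L; under eq_fun do rewrite mxE.
  exact: polyfun_coord.
- exact: cst_continuous.
near=> t; rewrite /L (lsubmx_step_map_quotient (w := rsubmx v)) //; last first.
  by rewrite linearD linearZ.
by near: t; exact: nbhs_dnbhs_neq.
Unshelve. all: by end_near. Qed.

(** By [step_map_increment] the difference quotients satisfy the identity with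
    M taken at the displaced image point; continuity of phi replaces that
    point by phi x in the limit. *)
Lemma rsubmx_jacobian_step_map x (v : 'rV[R]_(n + n)) :
  step_dom h f x -> rsubmx v = 0 ->
  rsubmx (v *m jacobian phi x) *m (M x)^T = - (lsubmx v *m (M (phi x))^T).
Proof.
move=> Dx v0; apply/rowP => j.
pose L (z : 'rV[R]_(n + n)) := (rsubmx z *m (M x)^T) 0 j.
pose G (z : 'rV[R]_(n + n)) := (- (lsubmx v *m (M z)^T)) 0 j.
have cphi : {for x, continuous phi}.
  exact/differentiable_continuous/differentiable_step_map.
have PM i k : polyfun (fun u => (M u)^T i k).
  by under eq_fun do rewrite mxE; exact: polyfun_density_mx.
have PG : polyfun G.
  rewrite /G; under eq_fun do rewrite mxE; apply/polyfunN/polyfun_mulmx => //.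
  by move=> i k; exact: polyfun_cst.
have -> : (- (lsubmx v *m (M (phi x))^T)) 0 j =
    (G \o phi \o (fun t : R => t *: v + x)) 0.
  by rewrite /= scale0r add0r.
have cline : {for 0, continuous (fun t : R => t *: v + x)}.
  by apply: cvgD; [apply: cvgZr_tmp; exact: cvg_id | exact: cvg_cst].
have near_dom : \forall t \near (0 : R), step_dom h f (t *: v + x).
  apply: (cline (step_dom h f)); rewrite scale0r add0r.
  exact: near_step_dom.
apply: (@mul_jacobian_eq _ _ _ phi x v L).
- exact: differentiable_step_map.
- apply/polyfun_continuous/polyfun_mulmx => i k; last exact: polyfun_cst.
  by rewrite (ord1 i); under eq_fun do rewrite mxE; exact: polyfun_coord.
- apply: continuous_comp => //=; rewrite scale0r add0r.
  apply: continuous_comp => //; exact: polyfun_continuous.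
near=> t.
have Dt : step_dom h f (t *: v + x).
  by near: t; exact: nbhs_dnbhs.
rewrite /L /G /= (rsubmx_step_map_quotient (w := lsubmx v)) //.
- by near: t; exact: nbhs_dnbhs_neq.
- by rewrite linearD linearZ /= v0 scaler0 add0r.
- by rewrite linearD linearZ.
Unshelve. all: by end_near. Qed.

(** The Jacobian matrix acts on rows from the right, so its upper blocks
    contain the derivatives in x0 and its lower ones those in x1: it has the
    shape (0, A; 1, B) with A transposed to dx2/dx0. *)
Lemma det_jacobian_step_map x : step_dom h f x ->
  \det (jacobian phi x) * \det (M x) = \det (M (phi x)).
Proof.
move=> Dx; set J := jacobian phi x.
have JE (w1 w2 : 'rV[R]_n) : row_mx w1 w2 *m J =
    row_mx (w1 *m ulsubmx J + w2 *m dlsubmx J)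
           (w1 *m ursubmx J + w2 *m drsubmx J).
  by rewrite -{1}[J]submxK mul_row_block.
have ul0 : ulsubmx J = 0.
  apply/row_matrixP => i; rewrite row0 rowE.
  have := lsubmx_jacobian_step_map (row_mx (delta_mx 0 i) 0) Dx.
  by rewrite -/J JE row_mxKl row_mxKr mul0mx addr0.
have dl1 : dlsubmx J = 1%:M.
  apply/row_matrixP => i; rewrite !rowE mulmx1.
  have := lsubmx_jacobian_step_map (row_mx 0 (delta_mx 0 i)) Dx.
  by rewrite -/J JE row_mxKl row_mxKr mul0mx add0r.
have urM : - ursubmx J *m (M x)^T = (M (phi x))^T.
  apply/row_matrixP => i; rewrite !rowE.
  have := rsubmx_jacobian_step_map Dx (row_mxKr (delta_mx 0 i) 0).
  rewrite -/J JE row_mxKr row_mxKl mul0mx addr0 -mulmxA => E.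
  by rewrite mulNmx mulmxN E opprK.
have detE (A B C : 'M[R]_n) : C *m A^T = B^T -> \det C * \det A = \det B.
  by move/(congr1 determinant); rewrite det_mulmx !det_tr.
by rewrite -[J]submxK ul0 dl1 det_block0l (detE _ _ _ urM).
Qed.

End Map.

Theorem proposition3 (R : realType) (n : nat) (hn : (1 <= n)%N)
    (h : R) (hh : h != 0)
    (K : 'M[R]_n) (hK : K^T = K)
    (W : mpoly n R) (hW : (msize W <= 5)%N) :
  let f := gradient_field K W in
  invariant_measure (step_dom h f) (step_map h f)
                    (density_dom h f) (density h f).
Proof.
move=> f; split=> [k||x Dx _ Dphix].
- exact: rational_step_map.
- exact: rational_density.
split; first exact: differentiable_step_map.
have quotE (a b c : R) : c * a = b -> b != 0 -> (b^-1 * c = a^-1)%R.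
  move=> <-; rewrite mulf_eq0 negb_or => /andP[c0 _].
  by rewrite invfM mulrC mulVKf.
exact: quotE (det_jacobian_step_map Dx) Dphix.
Qed.
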